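(* The satisfiability problem for $\exists^*\forall^*\mathsf{SL}(\mathsf{ELIA})_{U,U\times\mathsf{Int}}$ is undecidable: there is no algorithm which, given a sentence $\exists x_1\ldots\exists x_m\forall y_1\ldots\forall y_n ~.~\varphi$ with $\varphi$ a quantifier-free $\mathsf{SL}(\mathsf{ELIA})_{U,U\times\mathsf{Int}}$ formula (quantified variables of sort $U$ or $\mathsf{Int}$), decides whether it has a model.
   Context: $\mathsf{ELIA}$ is the theory whose signature extends linear integer arithmetic (sort $\mathsf{Int}$ interpreted as the integers, with $\geq$, $+$, $0$, $1$ interpreted as usual) with an uninterpreted sort $U$ (any nonempty countable set) equipped only with equality. $\mathsf{SL}(\mathsf{ELIA})_{U,U\times \mathsf{Int}}$ is separation logic with locations of sort $U$ and data of sort $U\times\mathsf{Int}$ (points-to atoms written $t\mapsto (d,u)$ or with the data tuple in the sort's order): formulas are generated by $\varphi ::= \phi \mid \mathsf{emp} \mid t \mapsto u \mid \varphi_1 * \varphi_2 \mid \varphi_1 \mathrel{-\!\!*} \varphi_2 \mid \neg\varphi_1 \mid \varphi_1 \wedge \varphi_2 \mid \exists x ~.~ \varphi_1$, where $\phi$ is an $\mathsf{ELIA}$ formula, $t$ a term of sort $U$, $u$ a term of the data sort; $\forall$ abbreviates $\neg\exists\neg$; $\mathsf{nil}$ is a designated constant of sort $U$. A heap is a finite partial function from $U^\mathcal{I}$ to $U^\mathcal{I}\times\mathbb{Z}$. Semantics: $\mathcal{I},h \models \phi$ iff $\mathcal{I} \models \phi$ for first-order $\phi$; $\mathcal{I},h\models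 \mathsf{emp}$ iff $h=\emptyset$; $\mathcal{I},h \models t\mapsto u$ iff $h=\{(t^\mathcal{I},u^\mathcal{I})\}$ and $t^\mathcal{I}\neq \mathsf{nil}^\mathcal{I}$; $\mathcal{I},h\models \varphi_1*\varphi_2$ iff $h = h_1 \uplus h_2$ (disjoint domains) with $\mathcal{I},h_i\models\varphi_i$; $\mathcal{I},h\models \varphi_1\mathrel{-\!\!*}\varphi_2$ iff for every heap $h'$ with domain disjoint from $\mathrm{dom}(h)$ and $\mathcal{I},h'\models\varphi_1$, $\mathcal{I},h'\uplus h\models\varphi_2$; $\mathcal{I},h\models\exists x^\sigma.\varphi$ iff $\mathcal{I}[x\leftarrow s],h\models\varphi$ for some $s\in\sigma^\mathcal{I}$; Boolean connectives are classical. A sentence is satisfiable if some model $\mathcal{I}$ of $\mathsf{ELIA}$ and heap $h$ satisfy it. *)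

(* Defs.v *)
From Stdlib Require Import ZArith List Arith.
Import ListNotations.
Open Scope Z_scope.

Inductive sort := SU | SI.

Inductive uterm := UVar (n : nat) | UNil.

Inductive iterm :=
  | IVar (n : nat) | IZero | IOne | IAdd (a b : iterm).

(* SL formulas. Pure (ELIA) atoms: equality on U, equality and >= on Int;
   Boolean combinations of them are obtained with FNot / FAnd.
   Points-to atoms  t |-> (d, u)  with d : U, u : Int. *)
Inductive form :=
  | FEqU (t1 t2 : uterm)
  | FEqI (a b : iterm)
  | FGeI (a b : iterm)
  | FEmp
  | FPto (t d : uterm) (u : iterm)
  | FSep (f g : form)
  | FWand (f g : form)
  | FNot (f : form)
  | FAnd (f g : form)
  | FExU (n : nat) (f : form)
  | FExI (n : nat) (f : form).

Definition FAllU n f := FNot (FExU n (FNot f)).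
Definition FAllI n f := FNot (FExI n (FNot f)).

Definition heap (U : Type) := U -> option (U * Z).

Definition hfinite {U} (h : heap U) : Prop :=
  exists l : list U, forall x, h x <> None -> In x l.

Definition hdisjoint {U} (h1 h2 : heap U) : Prop :=
  forall x, h1 x = None \/ h2 x = None.

Definition hunion {U} (h1 h2 : heap U) : heap U :=
  fun x => match h1 x with Some v => Some v | None => h2 x end.

Definition heq {U} (h1 h2 : heap U) : Prop := forall x, h1 x = h2 x.

Definition eval_u {U} (nil : U) (eu : nat -> U) (t : uterm) : U :=
  match t with UVar n => eu n | UNil => nil end.

Fixpoint eval_i (ei : nat -> Z) (a : iterm) : Z :=
  match a with
  | IVar n => ei n
  | IZero => 0
  | IOne => 1
  | IAdd a b => eval_i ei a + eval_i ei b
  end.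

Definition upd {A} (e : nat -> A) (n : nat) (v : A) : nat -> A :=
  fun m => if Nat.eqb m n then v else e m.

Fixpoint sl_sat {U : Type} (nil : U) (eu : nat -> U) (ei : nat -> Z)
    (h : heap U) (f : form) {struct f} : Prop :=
  match f with
  | FEqU t1 t2 => eval_u nil eu t1 = eval_u nil eu t2
  | FEqI a b => eval_i ei a = eval_i ei b
  | FGeI a b => eval_i ei a >= eval_i ei b
  | FEmp => forall x, h x = None
  | FPto t d u =>
      eval_u nil eu t <> nil /\
      h (eval_u nil eu t) = Some (eval_u nil eu d, eval_i ei u) /\
      forall x, x <> eval_u nil eu t -> h x = None
  | FSep f1 f2 =>
      exists h1 h2 : heap U,
        hfinite h1 /\ hfinite h2 /\ hdisjoint h1 h2 /\
        heq h (hunion h1 h2) /\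
        sl_sat nil eu ei h1 f1 /\ sl_sat nil eu ei h2 f2
  | FWand f1 f2 =>
      forall h' : heap U, hfinite h' -> hdisjoint h' h ->
        sl_sat nil eu ei h' f1 -> sl_sat nil eu ei (hunion h' h) f2
  | FNot f1 => ~ sl_sat nil eu ei h f1
  | FAnd f1 f2 => sl_sat nil eu ei h f1 /\ sl_sat nil eu ei h f2
  | FExU n f1 => exists s : U, sl_sat nil (upd eu n s) ei h f1
  | FExI n f1 => exists s : Z, sl_sat nil eu (upd ei n s) h f1
  end.

(* Satisfiability: some model of ELIA (U any nonempty countable set,
   nil in U) and some (finite) heap satisfy the formula.  For sentences
   the variable assignments eu / ei are irrelevant. *)
Definition satisfiable (f : form) : Prop :=
  exists (U : Type) (enc : U -> nat),
    (forall x y, enc x = enc y -> x = y) /\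
    exists (nil : U) (eu : nat -> U) (ei : nat -> Z) (h : heap U),
      hfinite h /\ sl_sat nil eu ei h f.

Fixpoint qfree (f : form) : Prop :=
  match f with
  | FSep a b | FWand a b | FAnd a b => qfree a /\ qfree b
  | FNot a => qfree a
  | FExU _ _ | FExI _ _ => False
  | _ => True
  end.

Definition uvars_ok (bu : list nat) (t : uterm) : Prop :=
  match t with UVar n => In n bu | UNil => True end.

Fixpoint ivars_ok (bi : list nat) (a : iterm) : Prop :=
  match a with
  | IVar n => In n bi
  | IAdd a b => ivars_ok bi a /\ ivars_ok bi b
  | _ => True
  end.

Fixpoint closed_in (bu bi : list nat) (f : form) : Prop :=
  match f with
  | FEqU t1 t2 => uvars_ok bu t1 /\ uvars_ok bu t2
  | FEqI a b | FGeI a b => ivars_ok bi a /\ ivars_ok bi b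
  | FEmp => True
  | FPto t d u => uvars_ok bu t /\ uvars_ok bu d /\ ivars_ok bi u
  | FSep a b | FWand a b | FAnd a b => closed_in bu bi a /\ closed_in bu bi b
  | FNot a => closed_in bu bi a
  | FExU n a => closed_in (n :: bu) bi a
  | FExI n a => closed_in bu (n :: bi) a
  end.

Definition sentence (f : form) : Prop := closed_in [] [] f.

Fixpoint ex_prefix (xs : list (sort * nat)) (f : form) : form :=
  match xs with
  | [] => f
  | (SU, n) :: r => FExU n (ex_prefix r f)
  | (SI, n) :: r => FExI n (ex_prefix r f)
  end.

Fixpoint all_prefix (ys : list (sort * nat)) (f : form) : form :=
  match ys with
  | [] => f
  | (SU, n) :: r => FAllU n (all_prefix r f)
  | (SI, n) :: r => FAllI n (all_prefix r f)
  end.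

Definition EA_sentence (f : form) : Prop :=
  sentence f /\
  exists xs ys phi, qfree phi /\ f = ex_prefix xs (all_prefix ys phi).

Definition npair (a b : nat) : nat :=
  Nat.div ((a + b) * (a + b + 1)) 2 + b.

Definition enc_u (t : uterm) : nat :=
  match t with UVar n => npair 0 n | UNil => npair 1 0 end.

Fixpoint enc_i (a : iterm) : nat :=
  match a with
  | IVar n => npair 0 n
  | IZero => npair 1 0
  | IOne => npair 2 0
  | IAdd a b => npair 3 (npair (enc_i a) (enc_i b))
  end.

Fixpoint enc_form (f : form) : nat :=
  match f with
  | FEqU t1 t2 => npair 0 (npair (enc_u t1) (enc_u t2))
  | FEqI a b => npair 1 (npair (enc_i a) (enc_i b))
  | FGeI a b => npair 2 (npair (enc_i a) (enc_i b))
  | FEmp => npair 3 0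
  | FPto t d u => npair 4 (npair (enc_u t) (npair (enc_u d) (enc_i u)))
  | FSep a b => npair 5 (npair (enc_form a) (enc_form b))
  | FWand a b => npair 6 (npair (enc_form a) (enc_form b))
  | FNot a => npair 7 (enc_form a)
  | FAnd a b => npair 8 (npair (enc_form a) (enc_form b))
  | FExU n a => npair 9 (npair n (enc_form a))
  | FExI n a => npair 10 (npair n (enc_form a))
  end.

Inductive prf :=
  | PZero
  | PSucc
  | PProj (i : nat)
  | PComp (f : prf) (gs : list prf)
  | PPrim (f g : prf)
  | PMu (f : prf).

Inductive peval : prf -> list nat -> nat -> Prop :=
  | ev_zero v : peval PZero v 0
  | ev_succ x v : peval PSucc (x :: v) (S x)
  | ev_proj i v : (i < length v)%nat -> peval (PProj i) v (nth i v 0%nat)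
  | ev_comp f gs v ws y :
      pevals gs v ws -> peval f ws y -> peval (PComp f gs) v y
  | ev_prim0 f g v y : peval f v y -> peval (PPrim f g) (0%nat :: v) y
  | ev_primS f g n v r y :
      peval (PPrim f g) (n :: v) r -> peval g (n :: r :: v) y ->
      peval (PPrim f g) (S n :: v) y
  | ev_mu f v n :
      peval f (n :: v) 0 ->
      (forall m, (m < n)%nat -> exists k, peval f (m :: v) (S k)) ->
      peval (PMu f) v n
with pevals : list prf -> list nat -> list nat -> Prop :=
  | evs_nil v : pevals [] v []
  | evs_cons g gs v w ws :
      peval g v w -> pevals gs v ws -> pevals (g :: gs) v (w :: ws).

Definition decides_EA_sat (p : prf) : Prop :=
  forall f, EA_sentence f ->
    (satisfiable f -> peval p [enc_form f] 1%nat) /\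
    (~ satisfiable f -> peval p [enc_form f] 0%nat).

(* Main.v *)
(* A register machine run is a list of configurations, each a fixed-length list of
   integers, so it fits into the heap as one linked list; a universally quantified
   window over two consecutive configurations checks the initial state, the
   transitions and the answer.  Every mu-recursive function is computed by such a
   machine, and a decider for satisfiability would be diagonalized by a sentence
   running it on its own code.  Since a decider answers on every sentence, only
   terminating runs have to be followed: by determinism the heap of any model
   follows that run, and neither cyclic heaps nor a converse simulation matter. *)
From Stdlib Require Import ZArith List Arith Lia Classical.
Require Import Defs.
Import ListNotations.
Open Scope nat_scope.

(** Self-reference works without a recursion theorem. The machine formula leaves its inputs [IVar 0]
    and [IVar 1] open, and equations in the matrix fix them to numerals: [m], the number of window
    cells, and [b], the code of the machine formula itself. From these two numbers a computable
    function rebuilds the code of the whole sentence. The window length has to be an input too: it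
    depends on the registers of the program, and the program contains the function that writes out
    the window quantifiers.

    No existential quantifier may follow the universal ones, so a window cannot ask for successor
    cells. They are universally quantified as well, and a premise discards every tuple that is not a
    path in the heap; that the path never ends is said by a quantifier-free allocation test built
    from the magic wand. In a finite heap the list of a halting run must therefore end in a loop,
    whose windows have to be harmless: only the heads of configurations are negative, and a halted
    configuration imposes nothing on what follows it. *)

(** * Closure properties of computable functions *)

Definition computable (k : nat) (f : list nat -> nat) : Prop :=
  exists p, forall v, length v = k -> peval p v (f v).

Lemma computable_proj k i : i < k -> computable k (fun v => nth i v 0).
Proof.
  intros Hi. exists (PProj i). intros v Hv. constructor. lia.
Qed.

Lemma computable_comp k f gs :
  computable (length gs) f -> Forall (computable k) gs ->
  computable k (fun v => f (map (fun g => g v) gs)).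
Proof.
  intros [p Hp] Hgs.
  assert (exists ps, forall v, length v = k -> pevals ps v (map (fun g => g v) gs))
    as [ps Hps].
  { clear p Hp. induction Hgs as [|g gs [pg Hg] _ [ps Hps]].
    - exists []. intros; constructor.
    - exists (pg :: ps). intros v Hv. simpl. constructor; auto. }
  exists (PComp p ps). intros v Hv. econstructor; [apply Hps; exact Hv|].
  apply Hp. apply length_map.
Qed.

Lemma computable_app1 k F g :
  computable 1 (fun v => F (nth 0 v 0)) -> computable k g ->
  computable k (fun v => F (g v)).
Proof.
  intros HF Hg. apply (computable_comp k _ [g] HF). auto.
Qed.

Lemma computable_app2 k F g1 g2 :
  computable 2 (fun v => F (nth 0 v 0) (nth 1 v 0)) ->
  computable k g1 -> computable k g2 ->
  computable k (fun v => F (g1 v) (g2 v)).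
Proof.
  intros HF H1 H2. apply (computable_comp k _ [g1; g2] HF). auto.
Qed.

Lemma computable_succ k g : computable k g -> computable k (fun v => S (g v)).
Proof.
  apply (computable_app1 k S). exists PSucc. intros [|x v] Hv; [discriminate|].
  constructor.
Qed.

Lemma computable_const k n : computable k (fun _ => n).
Proof.
  induction n as [|n IH].
  - exists PZero. intros; constructor.
  - apply (computable_succ k (fun _ => n) IH).
Qed.

Lemma computable_prim k f g F :
  computable k f -> computable (S (S k)) g ->
  (forall v, length v = k -> F (0 :: v) = f v) ->
  (forall n v, length v = k -> F (S n :: v) = g (n :: F (n :: v) :: v)) ->
  computable (S k) F.
Proof.
  intros [pf Hf] [pg Hg] F0 FS. exists (PPrim pf pg).
  intros [|n v] Hv; [discriminate|]. injection Hv as Hv.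
  induction n as [|n IH].
  - rewrite F0 by exact Hv. constructor. auto.
  - rewrite FS by exact Hv. econstructor; [exact IH|]. apply Hg. simpl. lia.
Qed.

Lemma computable_add k f g :
  computable k f -> computable k g -> computable k (fun v => f v + g v).
Proof.
  apply (computable_app2 k Nat.add).
  apply (computable_prim 1 (fun v => nth 0 v 0) (fun v => S (nth 1 v 0))).
  - apply computable_proj. lia.
  - apply computable_succ, computable_proj. lia.
  - reflexivity.
  - reflexivity.
Qed.

Definition triangular (n : nat) : nat := Nat.div (n * (n + 1)) 2.

(** Turns the division in Cantor's pairing function into a primitive recursion. *)
Lemma triangular_succ n : triangular (S n) = triangular n + S n.
Proof.
  unfold triangular. rewrite <- Nat.div_add by discriminate.
  replace (S n * (S n + 1)) with (n * (n + 1) + S n * 2) by ring. reflexivity.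
Qed.

Lemma computable_npair k f g :
  computable k f -> computable k g -> computable k (fun v => npair (f v) (g v)).
Proof.
  intros Hf Hg. change (computable k (fun v => triangular (f v + g v) + g v)).
  apply computable_add; [|exact Hg].
  apply (computable_app1 k triangular); [|apply computable_add; assumption].
  apply (computable_prim 0 (fun _ => 0) (fun v => nth 1 v 0 + S (nth 0 v 0))).
  - apply computable_const.
  - apply computable_add; [|apply computable_succ]; apply computable_proj; lia.
  - reflexivity.
  - intros n v _. apply triangular_succ.
Qed.

Fixpoint numeral (n : nat) : iterm :=
  match n with 0 => IZero | S n => IAdd IOne (numeral n) end.

Lemma eval_numeral ei n : eval_i ei (numeral n) = Z.of_nat n.
Proof.
  induction n as [|n IH]; [reflexivity|].
  change (1 + eval_i ei (numeral n) = Z.of_nat (S n))%Z. lia.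
Qed.

Lemma numeral_closed bi n : ivars_ok bi (numeral n).
Proof. induction n; simpl; auto. Qed.

Lemma computable_numeral k f :
  computable k f -> computable k (fun v => enc_i (numeral (f v))).
Proof.
  apply (computable_app1 k (fun n => enc_i (numeral n))).
  apply (computable_prim 0 (fun _ => enc_i IZero)
    (fun v => npair 3 (npair (enc_i IOne) (nth 1 v 0)))).
  - apply computable_const.
  - repeat apply computable_npair; try apply computable_const.
    apply computable_proj. lia.
  - reflexivity.
  - reflexivity.
Qed.

(** * Register machines *)

Inductive expr := EZero | ECopy (s : nat) | ESucc (s : nat).

Inductive instr :=
  | Assign (r : nat) (e : expr)
  | Jeq (r s l : nat).

Definition config : Type := nat * (nat -> nat).

Definition eval_expr (rho : nat -> nat) (e : expr) : nat :=
  match e with EZero => 0 | ECopy s => rho s | ESucc s => S (rho s) end.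

Definition exec (i : instr) (c : config) : config :=
  let (pc, rho) := c in
  match i with
  | Assign r e => (S pc, upd rho r (eval_expr rho e))
  | Jeq r s l => (if rho r =? rho s then l else S pc, rho)
  end.

Definition step (P : list instr) (c : config) : config :=
  match nth_error P (fst c) with Some i => exec i c | None => c end.

Definition steps (P : list instr) (c c' : config) : Prop :=
  exists n, Nat.iter n (step P) c = c'.

Lemma steps_refl P c : steps P c c.
Proof. exists 0. reflexivity. Qed.

Lemma steps_trans P c1 c2 c3 : steps P c1 c2 -> steps P c2 c3 -> steps P c1 c3.
Proof.
  intros [n <-] [m <-]. exists (m + n). apply Nat.iter_add.
Qed.

Definition code_at (P : list instr) (pc : nat) (C : list instr) : Prop :=
  exists A B, P = A ++ C ++ B /\ length A = pc.

Lemma code_at_app P pc C D :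
  code_at P pc (C ++ D) -> code_at P pc C /\ code_at P (pc + length C) D.
Proof.
  intros (A & B & -> & <-). split.
  - exists A, (D ++ B). rewrite <- !app_assoc. auto.
  - exists (A ++ C), B. rewrite length_app, <- !app_assoc. auto.
Qed.

Lemma code_at_cons P pc i C :
  code_at P pc (i :: C) -> nth_error P pc = Some i /\ code_at P (S pc) C.
Proof.
  intros H. split.
  - destruct H as (A & B & -> & <-). rewrite nth_error_app2, Nat.sub_diag; auto.
  - apply (code_at_app P pc [i] C) in H as [_ H].
    rewrite Nat.add_1_r in H. exact H.
Qed.

Lemma steps_instr P pc rho i c :
  nth_error P pc = Some i -> steps P (exec i (pc, rho)) c -> steps P (pc, rho) c.
Proof.
  intros Hi. apply steps_trans. exists 1. simpl. unfold step. simpl.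
  rewrite Hi. reflexivity.
Qed.

(* Code at address [pc] for [q]: inputs in the registers [ins], output in [out],
   scratch registers from [base] on. *)
Fixpoint compile (q : prf) (ins : list nat) (out base pc : nat) : list instr :=
  match q with
  | PZero => [Assign out EZero]
  | PSucc => [Assign out (ESucc (nth 0 ins 0))]
  | PProj i => [Assign out (ECopy (nth i ins 0))]
  | PComp f gs =>
      let base' := base + length gs in
      let cs := (fix compiles gs o pc := match gs with
        | [] => []
        | g :: gs => let c := compile g ins o base' pc in
                     c ++ compiles gs (S o) (pc + length c)
        end) gs base pc in
      cs ++ compile f (seq base (length gs)) out base' (pc + length cs)
  | PPrim f g =>
      let n := nth 0 ins 0 in
      let i := base in let acc := S base in let tmp := S (S base) in
      let base' := S (S (S base)) in
      let cf := compile f (tl ins) acc base' pc in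
      let loop := S (pc + length cf) in
      let cg := compile g (i :: acc :: tl ins) tmp base' (S loop) in
      cf ++ Assign i EZero ::
      Jeq i n (S loop + length cg + 3) ::
      cg ++ [Assign acc (ECopy tmp); Assign i (ESucc i); Jeq i i loop; Assign out (ECopy acc)]
  | PMu f =>
      let i := base in let t := S base in let z := S (S base) in
      let base' := S (S (S base)) in
      let loop := S (S pc) in
      let cf := compile f (i :: ins) t base' loop in
      Assign i EZero :: Assign z EZero ::
      cf ++ [Jeq t z (loop + length cf + 3); Assign i (ESucc i); Jeq i i loop;
             Assign out (ECopy i)]
  end.

(** The inner fixpoint of [compile] for argument lists, named so that it can be reasoned about by
    induction on [gs]. *)
Fixpoint compiles (gs : list prf) (ins : list nat) (o base pc : nat) : list instr :=
  match gs with
  | [] => []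
  | g :: gs => let c := compile g ins o base pc in
               c ++ compiles gs ins (S o) base (pc + length c)
  end.

Lemma compile_comp f gs ins out base pc :
  compile (PComp f gs) ins out base pc =
  let base' := base + length gs in
  let cs := compiles gs ins base base' pc in
  cs ++ compile f (seq base (length gs)) out base' (pc + length cs).
Proof.
  simpl.
  match goal with |- context [?F gs base pc] => set (cps := F) end.
  assert (E : forall l o a, cps l o a = compiles l ins o (base + length gs) a).
  { induction l as [|g l IH]; intros; simpl; [reflexivity|]. rewrite IH. reflexivity. }
  rewrite E. reflexivity.
Qed.

(** * Correctness of the compiled code *)

(** The last clause is a frame condition: a fragment with a larger [base] cannot disturb the inputs,
    counters and accumulators of the code around it. *)
Definition simulates (q : prf) : Prop :=
  forall v y ins out base pc rho P,
    peval q v y ->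
    code_at P pc (compile q ins out base pc) ->
    (forall r, In r ins -> r < base) -> out < base -> map rho ins = v ->
    exists rho',
      steps P (pc, rho) (pc + length (compile q ins out base pc), rho') /\
      rho' out = y /\ forall r, r < base -> r <> out -> rho' r = rho r.

Lemma upd_same {A} (e : nat -> A) n v : upd e n v n = v.
Proof. unfold upd. rewrite Nat.eqb_refl. reflexivity. Qed.

Lemma upd_other {A} (e : nat -> A) n v m : m <> n -> upd e n v m = e m.
Proof. intros H. unfold upd. apply Nat.eqb_neq in H. rewrite H. reflexivity. Qed.

Lemma simulates_set q :
  (forall ins, exists e, (forall out base pc, compile q ins out base pc = [Assign out e]) /\
    forall rho v y, map rho ins = v -> peval q v y -> eval_expr rho e = y) ->
  simulates q.
Proof.
  intros H v y ins out base pc rho P Hq HP Hins Hout Hv.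
  destruct (H ins) as (e & E & He). rewrite E in *.
  apply code_at_cons in HP as [HP _].
  exists (upd rho out (eval_expr rho e)). repeat split.
  - eapply steps_instr; [exact HP|]. simpl. rewrite Nat.add_1_r. apply steps_refl.
  - rewrite upd_same. eauto.
  - intros. apply upd_other. assumption.
Qed.

Lemma simulates_zero : simulates PZero.
Proof.
  apply simulates_set. intros ins. exists EZero. split; [reflexivity|].
  intros rho v y _ Hq. inversion Hq. reflexivity.
Qed.

Lemma simulates_succ : simulates PSucc.
Proof.
  apply simulates_set. intros ins. exists (ESucc (nth 0 ins 0)). split; [reflexivity|].
  intros rho v y Hv Hq. inversion Hq; subst. destruct ins; [discriminate|].
  injection H0. simpl. congruence.
Qed.

Lemma simulates_proj i : simulates (PProj i).
Proof.
  apply simulates_set. intros ins. exists (ECopy (nth i ins 0)). split; [reflexivity|].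
  intros rho v y Hv Hq. inversion Hq; subst. simpl.
  rewrite length_map in *. rewrite <- (map_nth rho).
  apply nth_indep. rewrite length_map. assumption.
Qed.

Lemma map_agree {A B} (f g : A -> B) l v :
  map f l = v -> (forall x, In x l -> g x = f x) -> map g l = v.
Proof. intros <-. apply map_ext_in. Qed.

Lemma simulates_comps gs :
  Forall simulates gs ->
  forall v ws ins o base pc rho P,
    pevals gs v ws ->
    code_at P pc (compiles gs ins o base pc) ->
    (forall r, In r ins -> r < o) -> o + length gs <= base -> map rho ins = v ->
    exists rho',
      steps P (pc, rho) (pc + length (compiles gs ins o base pc), rho') /\
      map rho' (seq o (length gs)) = ws /\ forall r, r < o -> rho' r = rho r.
Proof.
  induction 1 as [|g gs Hg _ IH]; intros v ws ins o base pc rho P Hq HP Hins Ho Hv;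
    inversion Hq as [|? ? ? w ws' Hw Hws]; subst; simpl in *.
  - exists rho. rewrite Nat.add_0_r. repeat split. apply steps_refl.
  - apply code_at_app in HP as [HP1 HP2].
    destruct (Hg _ _ ins o _ _ rho _ Hw HP1)
      as (rho1 & S1 & O1 & K1); [intros r Hr; specialize (Hins r Hr); lia|lia|reflexivity|].
    destruct (IH _ _ ins (S o) _ _ rho1 _ Hws HP2) as (rho2 & S2 & O2 & K2).
    + intros r Hr. specialize (Hins r Hr). lia.
    + lia.
    + eapply map_agree; [reflexivity|]. intros r Hr. specialize (Hins r Hr).
      apply K1; lia.
    + exists rho2. rewrite length_app, Nat.add_assoc. repeat split.
      * eapply steps_trans; eassumption.
      * f_equal; [rewrite K2 by lia; exact O1|exact O2].
      * intros r Hr. rewrite K2, K1 by lia. reflexivity.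
Qed.

Lemma simulates_comp f gs :
  simulates f -> Forall simulates gs -> simulates (PComp f gs).
Proof.
  intros Hf Hgs v y ins out base pc rho P Hq HP Hins Hout Hv.
  rewrite compile_comp in *. cbv zeta in *.
  inversion Hq as [| | |? ? ? ws ? Hws Hy| | |]; subst.
  apply code_at_app in HP as [HP1 HP2].
  destruct (simulates_comps gs Hgs _ _ ins base _ _ rho _ Hws HP1)
    as (rho1 & S1 & O1 & K1); auto.
  destruct (Hf _ _ _ _ _ _ rho1 _ Hy HP2) as (rho2 & S2 & O2 & K2); auto.
  - intros r Hr. apply in_seq in Hr. lia.
  - lia.
  - exists rho2. rewrite length_app, Nat.add_assoc. repeat split; auto.
    + eapply steps_trans; eassumption.
    + intros r Hr Hn. rewrite K2, K1 by lia. reflexivity.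
Qed.

Lemma simulates_prim f g : simulates f -> simulates g -> simulates (PPrim f g).
Proof.
  intros Hf Hg v y ins out base pc rho P Hq HP Hins Hout Hv.
  simpl in *.
  set (n := nth 0 ins 0) in *.
  set (cf := compile f _ _ _ _) in *. set (loop := pc + length cf) in *.
  set (cg := compile g _ _ _ _) in *.
  apply code_at_app in HP as [HPf HP].
  apply code_at_cons in HP as [HPi HP].
  apply code_at_cons in HP as [HPj HP].
  apply code_at_app in HP as [HPg HP].
  apply code_at_cons in HP as [HPa HP].
  apply code_at_cons in HP as [HPs HP].
  apply code_at_cons in HP as [HPl HP].
  apply code_at_cons in HP as [HPe _].
  fold loop in HPi, HPj, HPg, HPa, HPs, HPl, HPe.
  destruct ins as [|rn ins]; [subst v; inversion Hq|].
  simpl in n, cf, cg. subst v. simpl in Hq. subst n.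
  assert (Hrn : rn < base) by (apply Hins; left; reflexivity).
  assert (Hrs : forall r, In r ins -> r < base) by (intros; apply Hins; right; assumption).
  (* Loop invariant after [k] rounds. Here [loop] is the address of the counter reset, so the loop
     head that tests the counter is [S loop]. *)
  assert (L : forall k r, k <= rho rn -> peval (PPrim f g) (k :: map rho ins) r ->
    exists rho', steps P (pc, rho) (S loop, rho') /\ rho' base = k /\
      rho' (S base) = r /\ forall s, s < base -> rho' s = rho s).
  { induction k as [|k IH]; intros r Hk Hr; inversion Hr as [| | | |? ? ? ? H0|? ? ? ? r0 ? H0 H1|]; subst.
    - destruct (Hf _ _ _ _ _ _ rho _ H0 HPf) as (rho1 & S1 & O1 & K1); auto.
      { intros s Hs. specialize (Hrs s Hs). lia. }
      exists (upd rho1 base 0). repeat split.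
      + eapply steps_trans; [exact S1|].
        eapply steps_instr; [exact HPi|]. apply steps_refl.
      + apply upd_same.
      + rewrite upd_other by lia. exact O1.
      + intros s Hs. rewrite upd_other, K1 by lia. reflexivity.
    - destruct (IH r0) as (rho1 & S1 & I1 & A1 & K1); [lia|assumption|].
      assert (Hg1 : map rho1 (base :: S base :: ins) = k :: r0 :: map rho ins).
      { simpl. rewrite I1, A1. do 2 f_equal. apply map_ext_in. auto. }
      destruct (Hg _ _ _ _ _ _ rho1 _ H1 HPg) as (rho2 & S2 & O2 & K2); auto.
      { intros s [<-|[<-|Hs]]; [lia|lia|]. specialize (Hrs s Hs). lia. }
      exists (upd (upd rho2 (S base) r) base (S k)). repeat split.
      + eapply steps_trans; [exact S1|].
        eapply steps_instr; [exact HPj|]. simpl.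
        rewrite I1, K1 by exact Hrn.
        destruct (Nat.eqb_spec k (rho rn)); [lia|].
        eapply steps_trans; [exact S2|].
        eapply steps_instr; [exact HPa|]. simpl. rewrite O2.
        eapply steps_instr; [exact HPs|]. simpl.
        rewrite upd_other by lia. rewrite K2, I1 by lia.
        eapply steps_instr; [exact HPl|]. simpl.
        rewrite Nat.eqb_refl. apply steps_refl.
      + apply upd_same.
      + rewrite upd_other by lia. apply upd_same.
      + intros s Hs. rewrite !upd_other, K2, K1 by lia. reflexivity. }
  destruct (L _ _ (le_n _) Hq) as (rho1 & S1 & I1 & A1 & K1).
  exists (upd rho1 out y). repeat split.
  - eapply steps_trans; [exact S1|].
    eapply steps_instr; [exact HPj|]. simpl.
    rewrite I1, K1, Nat.eqb_refl by exact Hrn.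
    match goal with |- steps _ (?a, _) _ => replace a with
      (S (S (S (S (S loop) + length cg)))) by lia end.
    eapply steps_instr; [exact HPe|]. simpl. rewrite A1.
    rewrite length_app. simpl. rewrite length_app. simpl.
    match goal with |- steps _ (?a, _) (?b, _) => replace a with b
      by (unfold loop; lia) end.
    apply steps_refl.
  - apply upd_same.
  - intros r Hr Hn. rewrite upd_other, K1 by assumption. reflexivity.
Qed.

Lemma simulates_mu f : simulates f -> simulates (PMu f).
Proof.
  intros Hf v y ins out base pc rho P Hq HP Hins Hout Hv.
  simpl in *.
  set (loop := S (S pc)) in *. set (cf := compile f _ _ _ _) in *.
  apply code_at_cons in HP as [HPi HP].
  apply code_at_cons in HP as [HPz HP].
  apply code_at_app in HP as [HPf HP].
  apply code_at_cons in HP as [HPj HP].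
  apply code_at_cons in HP as [HPs HP].
  apply code_at_cons in HP as [HPl HP].
  apply code_at_cons in HP as [HPe _].
  fold loop in HPf, HPj, HPs, HPl, HPe.
  inversion Hq as [| | | | | |? ? ? H0 H1]; subst.
  assert (R : forall k r rho1, peval f (k :: map rho ins) r ->
    rho1 base = k -> rho1 (S (S base)) = 0 ->
    (forall s, s < base -> rho1 s = rho s) ->
    exists rho2, steps P (loop, rho1) (loop + length cf, rho2) /\ rho2 (S base) = r /\
      rho2 base = k /\ rho2 (S (S base)) = 0 /\ forall s, s < base -> rho2 s = rho s).
  { intros k r rho1 Hk I1 Z1 K1.
    assert (Hm : map rho1 (base :: ins) = k :: map rho ins).
    { simpl. rewrite I1. f_equal. apply map_ext_in. auto. }
    destruct (Hf _ _ _ _ _ _ rho1 _ Hk HPf) as (rho2 & S2 & O2 & K2); auto.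
    { intros s [<-|Hs]; [lia|]. specialize (Hins s Hs). lia. }
    exists rho2. repeat split; auto; intros; rewrite K2 by lia; auto. }
  (* Below [y] the values of [f] are successors, so the exit test against the zero register fails
     and the loop head is reached again. *)
  assert (L : forall k, k <= y -> exists rho1, steps P (pc, rho) (loop, rho1) /\
    rho1 base = k /\ rho1 (S (S base)) = 0 /\ forall s, s < base -> rho1 s = rho s).
  { induction k as [|k IH]; intros Hk.
    - exists (upd (upd rho base 0) (S (S base)) 0). repeat split.
      + eapply steps_instr; [exact HPi|]. eapply steps_instr; [exact HPz|].
        apply steps_refl.
      + rewrite upd_other by lia. apply upd_same.
      + apply upd_same.
      + intros s Hs. rewrite !upd_other by lia. reflexivity.
    - destruct IH as (rho1 & S1 & I1 & Z1 & K1); [lia|].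
      destruct (H1 k) as [r Hr]; [lia|].
      destruct (R _ _ _ Hr I1 Z1 K1) as (rho2 & S2 & O2 & I2 & Z2 & K2).
      exists (upd rho2 base (S k)). repeat split.
      + eapply steps_trans; [exact S1|]. eapply steps_trans; [exact S2|].
        eapply steps_instr; [exact HPj|]. simpl. rewrite O2, Z2. simpl.
        eapply steps_instr; [exact HPs|]. simpl. rewrite I2.
        eapply steps_instr; [exact HPl|]. simpl. rewrite Nat.eqb_refl.
        apply steps_refl.
      + apply upd_same.
      + rewrite upd_other by lia. exact Z2.
      + intros s Hs. rewrite upd_other by lia. auto. }
  destruct (L y (le_n _)) as (rho1 & S1 & I1 & Z1 & K1).
  destruct (R _ _ _ H0 I1 Z1 K1) as (rho2 & S2 & O2 & I2 & Z2 & K2).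
  exists (upd rho2 out y). repeat split.
  - eapply steps_trans; [exact S1|]. eapply steps_trans; [exact S2|].
    eapply steps_instr; [exact HPj|]. simpl. rewrite O2, Z2. simpl.
    match goal with |- steps _ (?a, _) _ => replace a with
      (S (S (S (loop + length cf)))) by (unfold loop; lia) end.
    eapply steps_instr; [exact HPe|]. simpl. rewrite I2.
    rewrite length_app. simpl.
    match goal with |- steps _ (?a, _) (?b, _) => replace a with b
      by (unfold loop; lia) end.
    apply steps_refl.
  - apply upd_same.
  - intros r Hr Hn. rewrite upd_other by assumption. auto.
Qed.

(** Structural recursion on the term, where the inner [fix] supplies the hypothesis for every member
    of [gs]. *)
Fixpoint simulates_all (q : prf) : simulates q :=
  match q with
  | PZero => simulates_zero
  | PSucc => simulates_succ
  | PProj i => simulates_proj i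
  | PComp f gs =>
      simulates_comp f gs (simulates_all f)
        ((fix all gs : Forall simulates gs :=
            match gs with
            | [] => Forall_nil _
            | g :: gs => Forall_cons g (simulates_all g) (all gs)
            end) gs)
  | PPrim f g => simulates_prim f g (simulates_all f) (simulates_all g)
  | PMu f => simulates_mu f (simulates_all f)
  end.

(** * Formulas *)

Definition FTrue : form := FEqI IZero IZero.
Definition FImp (f g : form) : form := FNot (FAnd f (FNot g)).

Fixpoint FConj (l : list form) : form :=
  match l with [] => FTrue | f :: l => FAnd f (FConj l) end.

Definition FPtoSub (t d : uterm) (u : iterm) : form := FSep (FPto t d u) FTrue.

(* For [t] allocated (or nil) no heap disjoint from the current one satisfies
   the left-hand side of the wand. *)
Definition FAlloc (t : uterm) : form :=
  FAnd (FNot (FEqU t UNil)) (FWand (FPto t UNil IZero) (FNot FTrue)).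

Lemma sat_imp {U} (nil : U) eu ei h f g :
  sl_sat nil eu ei h (FImp f g) <->
  (sl_sat nil eu ei h f -> sl_sat nil eu ei h g).
Proof. simpl. tauto. Qed.

Lemma sat_conj {U} (nil : U) eu ei h l :
  sl_sat nil eu ei h (FConj l) <-> forall f, In f l -> sl_sat nil eu ei h f.
Proof.
  induction l as [|g l IH]; simpl.
  - split; [intros _ f []|reflexivity].
  - rewrite IH. split.
    + intros [Hg Hl] f [<-|Hf]; auto.
    + auto.
Qed.

Lemma sat_conj_map {U A} (nil : U) eu ei h (F : A -> form) l :
  sl_sat nil eu ei h (FConj (map F l)) <->
  forall a, In a l -> sl_sat nil eu ei h (F a).
Proof.
  rewrite sat_conj. split.
  - intros H a Ha. apply H. apply in_map. exact Ha.
  - intros H f Hf. apply in_map_iff in Hf as (a & <- & Ha). auto.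
Qed.

(** The injection [enc] gives a Boolean equality test on [U], which cuts the heap into the cell at
    [x] and the rest. *)
Lemma sat_ptosub {U} (enc : U -> nat) (nil : U) eu ei h t d u :
  (forall x y, enc x = enc y -> x = y) -> hfinite h ->
  (sl_sat nil eu ei h (FPtoSub t d u) <->
   eval_u nil eu t <> nil /\
   h (eval_u nil eu t) = Some (eval_u nil eu d, eval_i ei u)).
Proof.
  intros inj [l Hl]. simpl. set (x := eval_u nil eu t). split.
  - intros (h1 & h2 & _ & _ & _ & E & (Hx & H1 & _) & _). split; [exact Hx|].
    rewrite E. unfold hunion. rewrite H1. reflexivity.
  - intros [Hx H].
    exists (fun y => if enc y =? enc x then h y else None),
      (fun y => if enc y =? enc x then None else h y).
    assert (Ex : forall y, (enc y =? enc x) = true -> y = x).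
    { intros y Hy. apply inj, Nat.eqb_eq, Hy. }
    repeat split; auto.
    + exists l. intros y. destruct (_ =? _); [apply Hl|congruence].
    + exists l. intros y. destruct (_ =? _); [congruence|apply Hl].
    + intros y. destruct (_ =? _); auto.
    + intros y. unfold hunion. destruct (_ =? _); [|reflexivity].
      destruct (h y); reflexivity.
    + rewrite Nat.eqb_refl. exact H.
    + intros y Hy. destruct (enc y =? enc x) eqn:E; [|reflexivity].
      apply Ex in E. contradiction.
Qed.

Lemma sat_alloc {U} (enc : U -> nat) (nil : U) eu ei h t :
  (forall x y, enc x = enc y -> x = y) ->
  (sl_sat nil eu ei h (FAlloc t) <->
   eval_u nil eu t <> nil /\ h (eval_u nil eu t) <> None).
Proof.
  intros inj. simpl. set (x := eval_u nil eu t). split; intros [Hx H]; split; auto.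
  (* If [x] were free, the singleton heap at [x] would satisfy the left side of the wand and force a
     falsehood. *)
  - intros Hn. apply (H (fun y => if enc y =? enc x then Some (nil, 0%Z) else None)).
    + exists [x]. intros y. destruct (enc y =? enc x) eqn:E; [|congruence].
      apply Nat.eqb_eq, inj in E. subst. left. reflexivity.
    + intros y. destruct (enc y =? enc x) eqn:E; [|auto].
      apply Nat.eqb_eq, inj in E. subst. auto.
    + repeat split; auto.
      * rewrite Nat.eqb_refl. reflexivity.
      * intros y Hy. destruct (enc y =? enc x) eqn:E; [|auto].
        apply Nat.eqb_eq, inj in E. contradiction.
    + reflexivity.
  - intros h' _ D (_ & Hh' & _). exfalso. destruct (D x) as [E|E].
    + rewrite E in Hh'. discriminate.
    + contradiction.
Qed.

(* [UVar 0] is the address of the first cell, [IVar 0] and [IVar 1] the machine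
   inputs; the window read from the heap consists of the cells at the addresses
   [addr i] with contents [cell i], and the universal block binds the first [m]
   of them. *)
Definition addr (i : nat) : uterm := UVar (S i).
Definition cell (i : nat) : iterm := IVar (S (S i)).

Fixpoint window_vars (m : nat) : list (sort * nat) :=
  match m with
  | 0 => []
  | S m => (SU, S m) :: (SI, S (S m)) :: window_vars m
  end.

(** The clauses on unchanged variables carry the induction: inner binders must keep both the values
    chosen by outer ones and the three variables bound outside the window. *)
Lemma sat_window_elim {U} (nil : U) h f m (y : nat -> U) (a : nat -> Z) :
  forall eu ei,
  sl_sat nil eu ei h (all_prefix (window_vars m) f) ->
  exists eu' ei',
    (forall i, i < m -> eu' (S i) = y i /\ ei' (S (S i)) = a i) /\
    (forall i, i = 0 \/ m < i -> eu' i = eu i) /\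
    (forall i, i < 2 \/ S m < i -> ei' i = ei i) /\
    sl_sat nil eu' ei' h f.
Proof.
  induction m as [|m IH]; intros eu ei H.
  - exists eu, ei. repeat split; auto; lia.
  - simpl in H.
    assert (H' : sl_sat nil (upd eu (S m) (y m)) (upd ei (S (S m)) (a m)) h
      (all_prefix (window_vars m) f)).
    (* Universal quantifiers are negated existentials, so instantiating one takes a double
       negation. *)
    { apply NNPP. intros N. apply H. exists (y m). intros N2. apply N2.
      exists (a m). exact N. }
    destruct (IH _ _ H') as (eu' & ei' & E & Eu & Ei & Hf).
    exists eu', ei'. split; [|split; [|split; [|exact Hf]]].
    + intros i Hi. destruct (Nat.eq_dec i m) as [->|Hn]; [|apply E; lia].
      rewrite Eu, Ei, !upd_same by lia. auto.
    + intros i Hi. rewrite Eu, upd_other by lia. reflexivity.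
    + intros i Hi. rewrite Ei, upd_other by lia. reflexivity.
Qed.

Lemma sat_window_intro {U} (nil : U) h f m :
  forall eu ei,
  (forall eu' ei', eu' 0 = eu 0 -> ei' 0 = ei 0 -> ei' 1 = ei 1 ->
    sl_sat nil eu' ei' h f) ->
  sl_sat nil eu ei h (all_prefix (window_vars m) f).
Proof.
  induction m as [|m IH]; intros eu ei H; simpl.
  - auto.
  - intros [y N]. apply N. intros [a N2]. apply N2. apply IH.
    intros eu' ei' E0 E1 E2. apply H; [rewrite E0|rewrite E1|rewrite E2];
      apply upd_other; discriminate.
Qed.

Lemma window_closed f m : forall bu bi,
  (forall bu' bi', incl bu bu' -> incl bi bi' ->
    (forall i, i < m -> In (S i) bu' /\ In (S (S i)) bi') -> closed_in bu' bi' f) ->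
  closed_in bu bi (all_prefix (window_vars m) f).
Proof.
  induction m as [|m IH]; intros bu bi H; simpl.
  - apply H; auto using incl_refl. intros; lia.
  - apply IH. intros bu' bi' Iu Ii Hm. apply H.
    + intros i Hi. apply Iu. right. exact Hi.
    + intros i Hi. apply Ii. right. exact Hi.
    + intros i Hi. destruct (Nat.eq_dec i m) as [->|Hn]; [|apply Hm; lia].
      split; [apply Iu|apply Ii]; left; reflexivity.
Qed.

(* A configuration occupies [S R] consecutive cells, the first one holding
   [- (pc + 1)]: the sign distinguishes it from the register cells. *)
Definition encodes (R : nat) (w : nat -> Z) (c : config) : Prop :=
  w 0 = (- Z.of_nat (S (fst c)))%Z /\ forall r, r < R -> w (S r) = Z.of_nat (snd c r).

(** Terms have no subtraction, so the negative head value is expressed by adding its absolute value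
    and comparing with zero. *)
Definition FPc (o j : nat) : form := FEqI (IAdd (cell o) (numeral (S j))) IZero.
Definition reg (o r : nat) : iterm := cell (o + S r).

Definition FRegs (R o : nat) (t : nat -> iterm) : form :=
  FConj (map (fun r => FEqI (reg o r) (t r)) (seq 0 R)).

Definition expr_term (e : expr) : iterm :=
  match e with
  | EZero => IZero
  | ECopy s => reg 0 s
  | ESucc s => IAdd (reg 0 s) IOne
  end.

Definition FExec (R j : nat) (i : instr) : form :=
  match i with
  | Assign r e =>
      FAnd (FPc (S R) (S j))
        (FRegs R (S R) (fun r' => if r' =? r then expr_term e else reg 0 r'))
  | Jeq r s l =>
      FAnd (FAnd (FImp (FEqI (reg 0 r) (reg 0 s)) (FPc (S R) l))
                 (FImp (FNot (FEqI (reg 0 r) (reg 0 s))) (FPc (S R) (S j))))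
        (FRegs R (S R) (reg 0))
  end.

Definition initial (a b r : nat) : nat :=
  match r with 0 => a | 1 => b | _ => 0 end.

Definition init_term (r : nat) : iterm :=
  match r with 0 => IVar 0 | 1 => IVar 1 | _ => IZero end.

Definition FTrans (R : nat) (P : list instr) : form :=
  FAnd (FConj (map (fun j => FImp (FPc 0 j)
                 (match nth_error P j with Some i => FExec R j i | None => FTrue end))
               (seq 0 (length P))))
       (FImp (FPc 0 (length P)) (FEqI (reg 0 2) IZero)).

Definition FCellAt (i : nat) : form := FPtoSub (addr i) (addr (S i)) (cell i).

(** Two configurations of [S R] cells. The quantifier block is one longer, because the pointer of
    the last cell needs a variable for its target. *)
Definition window_size (R : nat) : nat := S R + S R.

Definition FMachine (R : nat) (P : list instr) : form :=
  FAnd (FAlloc (UVar 0))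
    (FAnd (FImp (FCellAt 0) (FAlloc (addr 1)))
      (FImp (FConj (map FCellAt (seq 0 (window_size R))))
        (FAnd (FImp (FEqU (addr 0) (UVar 0)) (FAnd (FPc 0 0) (FRegs R 0 init_term)))
              (FTrans R P)))).

Definition expr_bounded (R : nat) (e : expr) : Prop :=
  match e with EZero => True | ECopy s | ESucc s => s < R end.

(** A register has to be stored in the heap only if it is read; writes to registers from [R] on are
    invisible both to the formula and to the later run. *)
Definition instr_bounded (R : nat) (i : instr) : Prop :=
  match i with
  | Assign _ e => expr_bounded R e
  | Jeq r s _ => r < R /\ s < R
  end.

Lemma bound_exists P : exists R, 2 < R /\ Forall (instr_bounded R) P.
Proof.
  induction P as [|i P (R & HR & IH)].
  - exists 3. auto.
  - assert (exists R', instr_bounded R' i) as [R' HR'].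
    { destruct i as [r [|s|s]|r s l]; simpl.
      - exists 0. exact I.
      - exists (S s). lia.
      - exists (S s). lia.
      - exists (S (r + s)). lia. }
    assert (M : forall j A B, A <= B -> instr_bounded A j -> instr_bounded B j).
    { intros [? []|] A B HAB; simpl; lia. }
    exists (R + R'). split; [lia|]. constructor.
    + apply (M _ R'); [lia|exact HR'].
    + eapply Forall_impl; [|exact IH]. intros j. apply M. lia.
Qed.

(** * Meaning of the machine formula in a heap *)

Lemma sat_pc {U} (nil : U) eu ei h o j :
  sl_sat nil eu ei h (FPc o j) <-> ei (S (S o)) = (- Z.of_nat (S j))%Z.
Proof.
  change ((ei (S (S o)) + eval_i ei (numeral (S j)))%Z = 0%Z <->
    ei (S (S o)) = (- Z.of_nat (S j))%Z).
  rewrite eval_numeral. lia.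
Qed.

Lemma sat_regs {U} (nil : U) eu ei h R o t :
  sl_sat nil eu ei h (FRegs R o t) <->
  forall r, r < R -> ei (S (S (o + S r))) = eval_i ei (t r).
Proof.
  unfold FRegs. rewrite sat_conj_map. simpl. split.
  - intros H r Hr. apply H. apply in_seq. lia.
  - intros H r Hr. apply in_seq in Hr. apply H. lia.
Qed.

Definition block (ei : nat -> Z) (o i : nat) : Z := ei (S (S (o + i))).

Lemma sat_pc_regs {U} (nil : U) eu ei h R o t c :
  (forall r, r < R -> eval_i ei (t r) = Z.of_nat (snd c r)) ->
  (sl_sat nil eu ei h (FAnd (FPc o (fst c)) (FRegs R o t)) <->
   encodes R (block ei o) c).
Proof.
  intros Ht.
  change (sl_sat nil eu ei h (FPc o (fst c)) /\ sl_sat nil eu ei h (FRegs R o t) <->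
    encodes R (block ei o) c).
  rewrite sat_pc, sat_regs. unfold encodes, block. rewrite Nat.add_0_r.
  split; intros [H1 H2]; split; auto; intros r Hr; rewrite H2; auto.
  symmetry; auto.
Qed.

(** Since the first block holds natural numbers, the integer comparison in the formula decides the
    jump, and the terms in [FRegs] evaluate to the new registers. *)
Lemma sat_exec {U} (nil : U) eu ei h R j i rho :
  instr_bounded R i -> encodes R (block ei 0) (j, rho) ->
  (sl_sat nil eu ei h (FExec R j i) <->
   encodes R (block ei (S R)) (exec i (j, rho))).
Proof.
  intros Hi [_ H0]. destruct i as [r e|r s l]; simpl in Hi.
  - apply (sat_pc_regs nil eu ei h R (S R) _ (S j, upd rho r (eval_expr rho e))).
    intros r' Hr'. simpl. unfold upd. destruct (r' =? r); [|apply H0, Hr'].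
    destruct e as [|s|s]; simpl in *.
    + reflexivity.
    + apply H0, Hi.
    + rewrite (H0 s Hi : ei (S (S (S s))) = _). simpl. lia.
  - assert (Hreg : forall r, r < R -> eval_i ei (reg 0 r) = Z.of_nat (rho r)) by exact H0.
    destruct Hi as [Hr Hs].
    rewrite <- (sat_pc_regs nil eu ei h R (S R) (reg 0)).
    2: { intros r' Hr'. simpl exec. apply Hreg, Hr'. }
    assert (Heq : eval_i ei (reg 0 r) = eval_i ei (reg 0 s) <-> rho r = rho s).
    { rewrite !Hreg by assumption. apply Nat2Z.inj_iff. }
    change (((sl_sat nil eu ei h (FImp (FEqI (reg 0 r) (reg 0 s)) (FPc (S R) l)) /\
      sl_sat nil eu ei h (FImp (FNot (FEqI (reg 0 r) (reg 0 s))) (FPc (S R) (S j)))) /\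
      sl_sat nil eu ei h (FRegs R (S R) (reg 0))) <->
      sl_sat nil eu ei h (FPc (S R) (if rho r =? rho s then l else S j)) /\
      sl_sat nil eu ei h (FRegs R (S R) (reg 0))).
    rewrite !sat_imp.
    change (sl_sat nil eu ei h (FNot ?a)) with (~ sl_sat nil eu ei h a).
    change (sl_sat nil eu ei h (FEqI (reg 0 r) (reg 0 s))) with
      (eval_i ei (reg 0 r) = eval_i ei (reg 0 s)).
    rewrite Heq. destruct (Nat.eqb_spec (rho r) (rho s)); tauto.
Qed.

(** Offset 3 of a block is register 2, the output: the head occupies offset 0. Halting means
    reaching address [length P]. *)
Lemma sat_trans {U} (nil : U) eu ei h R P :
  sl_sat nil eu ei h (FTrans R P) <->
  (forall j i, nth_error P j = Some i -> block ei 0 0 = (- Z.of_nat (S j))%Z ->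
    sl_sat nil eu ei h (FExec R j i)) /\
  (block ei 0 0 = (- Z.of_nat (S (length P)))%Z -> block ei 0 3 = 0%Z).
Proof.
  unfold FTrans.
  match goal with |- sl_sat _ _ _ _ (FAnd ?f ?g) <-> _ =>
    change (sl_sat nil eu ei h f /\ sl_sat nil eu ei h g <->
  (forall j i, nth_error P j = Some i -> block ei 0 0 = (- Z.of_nat (S j))%Z ->
    sl_sat nil eu ei h (FExec R j i)) /\
  (block ei 0 0 = (- Z.of_nat (S (length P)))%Z -> block ei 0 3 = 0%Z)) end.
  rewrite sat_imp, sat_pc, sat_conj_map.
  apply and_iff_compat_r. split.
  - intros H j i Hj Hpc. specialize (H j). rewrite sat_imp, sat_pc, Hj in H.
    apply H; [|exact Hpc]. apply in_seq.
    enough (j < length P) by lia. apply nth_error_Some. congruence.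
  - intros H j _. rewrite sat_imp, sat_pc. intros Hpc.
    destruct (nth_error P j) as [i|] eqn:E; [|reflexivity]. apply H; assumption.
Qed.

Lemma sat_machine {U} (enc : U -> nat) (nil : U) eu ei h R P :
  (forall x y, enc x = enc y -> x = y) -> hfinite h ->
  let cell_at i := eu (S i) <> nil /\ h (eu (S i)) = Some (eu (S (S i)), ei (S (S i))) in
  (sl_sat nil eu ei h (FMachine R P) <->
   (eu 0 <> nil /\ h (eu 0) <> None) /\
   (cell_at 0 -> eu 2 <> nil /\ h (eu 2) <> None) /\
   ((forall i, i < window_size R -> cell_at i) ->
    (eu 1 = eu 0 -> sl_sat nil eu ei h (FAnd (FPc 0 0) (FRegs R 0 init_term))) /\
    sl_sat nil eu ei h (FTrans R P))).
Proof.
  intros inj Hh cell_at.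
  assert (C : forall i, sl_sat nil eu ei h (FCellAt i) <-> cell_at i).
  { intros i. apply (sat_ptosub enc); assumption. }
  assert (W : sl_sat nil eu ei h (FConj (map FCellAt (seq 0 (window_size R)))) <->
    forall i, i < window_size R -> cell_at i).
  { rewrite sat_conj_map. split.
    - intros H i Hi. apply C, H, in_seq. lia.
    - intros H i Hi. apply in_seq in Hi. apply C, H. lia. }
  unfold FMachine.
  set (I := FImp (FEqU _ _) _). set (T := FTrans R P).
  set (A := FAlloc (UVar 0)). set (N := FImp (FCellAt 0) _). set (cs := FConj _) in *.
  change (sl_sat nil eu ei h (FAnd A (FAnd N (FImp cs (FAnd I T))))) with
    (sl_sat nil eu ei h A /\ sl_sat nil eu ei h N /\
     sl_sat nil eu ei h (FImp cs (FAnd I T))).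
  subst A N. rewrite !sat_imp, !(sat_alloc enc), W, C by assumption.
  change (sl_sat nil eu ei h (FAnd I T)) with
    (sl_sat nil eu ei h I /\ sl_sat nil eu ei h T).
  subst I. rewrite sat_imp. reflexivity.
Qed.

(** * Satisfiability of an instance and the answer of its machine *)

(** The numerals enter outside [f], so [f] can be fixed before its own code is known. *)
Definition instance (m b : nat) (f : form) : form :=
  FExU 0 (FExI 0 (FExI 1 (all_prefix (window_vars m)
    (FAnd (FAnd (FEqI (IVar 0) (numeral m)) (FEqI (IVar 1) (numeral b))) f)))).

Lemma init_term_eval ei a b r :
  ei 0 = Z.of_nat a -> ei 1 = Z.of_nat b ->
  eval_i ei (init_term r) = Z.of_nat (initial a b r).
Proof. destruct r as [|[|r]]; simpl; auto. Qed.

Lemma instance_sound R P b n rho :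
  2 < R -> Forall (instr_bounded R) P ->
  let m := S (window_size R) in
  satisfiable (instance m b (FMachine R P)) ->
  Nat.iter n (step P) (0, initial m b) = (length P, rho) -> rho 2 = 0.
Proof.
  intros HR HP m (U & enc & inj & nil & eu & ei & h & Hh & x0 & z1 & z2 & H) Hn.
  (* Outside the heap [nxt] stays put and [dat] is 0; these defaults only make [chain] and [word]
     total, and the run is read from allocated addresses alone. *)
  pose (nxt u := match h u with Some (v, _) => v | None => u end).
  pose (dat u := match h u with Some (_, a) => a | None => 0%Z end).
  pose (chain u i := Nat.iter i nxt u).
  pose (good u := u <> nil /\ h u <> None).
  pose (word u i := dat (chain u i)).
  assert (W : forall u, exists eu' ei',
    (forall i, i < m -> eu' (S i) = chain u i /\ ei' (S (S i)) = word u i) /\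
    eu' 0 = x0 /\ ei' 0 = Z.of_nat m /\ ei' 1 = Z.of_nat b /\
    sl_sat nil eu' ei' h (FMachine R P)).
  { intros u.
    destruct (sat_window_elim nil h _ m (chain u) (word u) _ _ H)
      as (eu' & ei' & E & Eu & Ei & (H1 & H2) & HM).
    exists eu', ei'. split; [exact E|]. split; [|split; [|split; [|exact HM]]].
    - rewrite Eu by auto. reflexivity.
    - rewrite <- (eval_numeral ei'). exact H1.
    - rewrite <- (eval_numeral ei'). exact H2. }
  assert (G0 : good x0).
  { destruct (W x0) as (eu' & ei' & _ & E0 & _ & _ & HM).
    apply (sat_machine enc) in HM as (HA & _); auto. rewrite E0 in HA. exact HA. }
  assert (G1 : forall u, good u -> good (nxt u)).
  { intros u [Gu1 Gu2]. destruct (W u) as (eu' & ei' & E & _ & _ & _ & HM).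
    apply (sat_machine enc) in HM as (_ & HN & _); auto.
    destruct (E 0) as [E0 E1]; [unfold m; lia|].
    destruct (E 1) as [E2 _]; [unfold m, window_size; lia|].
    rewrite E0, E1, E2 in HN. apply HN. split; [exact Gu1|].
    unfold word, chain, dat, nxt. simpl. destruct (h u) as [[v a]|]; congruence. }
  assert (GC : forall u i, good u -> good (chain u i)).
  { intros u i Gu. induction i; [exact Gu|]. apply G1. assumption. }
  (* Along a chain of good addresses every window cell is genuine, so the premise of the machine
     formula is met. *)
  assert (T : forall u, good u -> exists eu' ei',
    (forall i, i < window_size R -> block ei' 0 i = word u i) /\
    (u = x0 -> encodes R (block ei' 0) (0, initial m b)) /\
    sl_sat nil eu' ei' h (FTrans R P)).
  { intros u Gu. destruct (W u) as (eu' & ei' & E & E0 & Z1 & Z2 & HM).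
    apply (sat_machine enc) in HM as (_ & _ & HW); auto.
    destruct HW as [HI HT].
    { intros i Hi. destruct (E i) as [-> ->]; [unfold m; lia|].
      destruct (E (S i)) as [-> _]; [unfold m; lia|].
      destruct (GC u i Gu) as [N1 N2]. split; [exact N1|].
      unfold word, dat. change (chain u (S i)) with (nxt (chain u i)).
      unfold nxt. destruct (h (chain u i)) as [[v a]|]; congruence. }
    exists eu', ei'. split; [|split; [|exact HT]].
    - intros i Hi. apply E. unfold m. lia.
    - intros ->. apply (sat_pc_regs nil eu' ei' h R 0 init_term (0, initial m b)).
      + intros r _. apply init_term_eval; assumption.
      + apply HI. rewrite E0. apply E. unfold m. lia. }
  (* The transition clause determines the block that follows, so the run is found by moving [S R]
     cells per step. Once no instruction applies, [step] is the identity and [u] is kept. *)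
  assert (B : forall k, exists u, good u /\
    encodes R (word u) (Nat.iter k (step P) (0, initial m b))).
  { induction k as [|k (u & Gu & Eu)].
    - exists x0. split; [exact G0|]. destruct (T x0 G0) as (eu' & ei' & E & I & _).
      destruct (I eq_refl) as [I1 I2]. split.
      + rewrite <- E by (unfold window_size; lia). exact I1.
      + intros r Hr. rewrite <- E by (unfold window_size; lia). auto.
    - simpl. destruct (Nat.iter k _ _) as [pc rho1]. unfold step. simpl.
      destruct (nth_error P pc) as [i|] eqn:Ei; [|exists u; auto].
      exists (chain u (S R)). split; [apply GC, Gu|].
      destruct (T u Gu) as (eu' & ei' & E & _ & HT).
      apply sat_trans in HT as [HT _].
      assert (E0 : encodes R (block ei' 0) (pc, rho1)).
      { destruct Eu as [I1 I2]. split.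
        - rewrite E by (unfold window_size; lia). exact I1.
        - intros r Hr. rewrite E by (unfold window_size; lia). auto. }
      specialize (HT pc i Ei (proj1 E0)). rewrite sat_exec in HT.
      2: { eapply Forall_forall; [exact HP|]. eapply nth_error_In, Ei. }
      2: exact E0.
      assert (S1 : forall j, j < S R -> word (chain u (S R)) j = block ei' (S R) j).
      { intros j Hj. change (block ei' (S R) j) with (block ei' 0 (S R + j)).
        rewrite E by (unfold window_size; lia). unfold word, chain. f_equal.
        rewrite <- Nat.iter_add, Nat.add_comm. reflexivity. }
      destruct HT as [I1 I2]. split.
      + rewrite S1 by lia. exact I1.
      + intros r Hr. rewrite S1 by lia. auto. }
  destruct (B n) as (u & Gu & I1 & I2). rewrite Hn in I1, I2.
  destruct (T u Gu) as (eu' & ei' & E & _ & HT). apply sat_trans in HT as [_ HT].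
  rewrite !E in HT by (unfold window_size; lia).
  specialize (HT I1). rewrite (I2 2 HR) in HT. simpl in HT. lia.
Qed.

Lemma block_div k t i : i < k -> (t * k + i) / k = t /\ (t * k + i) mod k = i.
Proof.
  intros Hi. split.
  - rewrite Nat.div_add_l, Nat.div_small by lia. lia.
  - rewrite Nat.add_comm, Nat.Div0.mod_add. apply Nat.mod_small. exact Hi.
Qed.

(** The run is laid out at addresses 1 to [len], with 0 as [nil]. A window starting at a register
    cell has a nonnegative head, so no transition clause fires; one starting at the last
    configuration meets only the halting clause, which asks for the given answer 0. *)
Lemma instance_complete R P b n rho :
  2 < R -> Forall (instr_bounded R) P ->
  let m := S (window_size R) in
  Nat.iter n (step P) (0, initial m b) = (length P, rho) -> rho 2 = 0 ->
  satisfiable (instance m b (FMachine R P)).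
Proof.
  intros HR HP m Hn Ho.
  pose (conf t := Nat.iter t (step P) (0, initial m b)).
  (* Room for the [n + 1] configurations at times 0 to [n], both ends included. *)
  pose (len := S n * S R).
  pose (dat j := match j mod S R with
    | 0 => Z.opp (Z.of_nat (S (fst (conf (j / S R)))))
    | S r => Z.of_nat (snd (conf (j / S R)) r)
    end).
  (* The last cell loops, so that every address reachable from 1 is allocated. *)
  pose (h := fun l : nat => if andb (1 <=? l) (l <=? len) then
    Some (if l =? len then l else S l, dat (l - 1)) else None).
  assert (Hlen : S R <= len) by (unfold len; lia).
  assert (Hin : forall l, 1 <= l <= len ->
    h l = Some (if l =? len then l else S l, dat (l - 1))).
  { intros l Hl. unfold h. destruct (Nat.leb_spec 1 l), (Nat.leb_spec l len); auto; lia. }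
  assert (Hdom : forall l, h l <> None -> 1 <= l <= len).
  { intros l. unfold h. destruct (Nat.leb_spec 1 l), (Nat.leb_spec l len); simpl; tauto. }
  assert (Hfin : hfinite h).
  { exists (seq 1 len). intros l Hl. apply in_seq. apply Hdom in Hl. lia. }
  assert (Hdat : forall t w, (forall i, i < S R -> w i = dat (t * S R + i)) ->
    encodes R w (conf t)).
  { intros t w Hw. split.
    - rewrite Hw by lia. unfold dat. destruct (block_div (S R) t 0) as [-> ->]; auto. lia.
    - intros r Hr. rewrite Hw by lia. unfold dat.
      destruct (block_div (S R) t (S r)) as [-> ->]; auto. lia. }
  exists nat, (fun x => x). split; [auto|].
  exists 0, (fun _ => 0), (fun _ => 0%Z), h. split; [exact Hfin|].
  exists 1, (Z.of_nat m), (Z.of_nat b).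
  apply sat_window_intro. intros eu ei Ex E0 E1.
  change (eu 0 = 1) in Ex. change (ei 0 = Z.of_nat m) in E0.
  change (ei 1 = Z.of_nat b) in E1.
  split; [split|].
  - change (ei 0 = eval_i ei (numeral m)). rewrite eval_numeral. exact E0.
  - change (ei 1 = eval_i ei (numeral b)). rewrite eval_numeral. exact E1.
  - apply (sat_machine (fun x => x)); auto. rewrite Ex. split; [|split].
    + rewrite Hin by lia. split; discriminate.
    + intros [_ HC]. assert (Hr : 1 <= eu 1 <= len) by (apply Hdom; congruence).
      rewrite Hin in HC by exact Hr. injection HC as HC _.
      assert (Hr2 : 1 <= eu 2 <= len).
      { rewrite <- HC. destruct (Nat.eqb_spec (eu 1) len); lia. }
      rewrite Hin by exact Hr2. split; [lia|discriminate].
    + intros HC.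
      assert (Hr : 1 <= eu 1 <= len).
      { apply Hdom. destruct (HC 0) as [_ HC0]; [unfold window_size; lia|congruence]. }
      (* Up to [len] the pointers lead to the next address; beyond it the final self-loop repeats
         the last cell, hence the bound. *)
      assert (HW : forall i, i < window_size R -> eu 1 + i <= len ->
        eu (S i) = eu 1 + i /\ block ei 0 i = dat (eu 1 - 1 + i)).
      { intros i Hi Hl.
        assert (Ha : eu (S i) = eu 1 + i).
        { revert Hi Hl. induction i as [|i IH]; intros Hi Hl; [lia|].
          destruct (HC i) as [_ HCi]; [lia|]. rewrite IH in HCi by lia.
          rewrite Hin in HCi by lia. injection HCi as HCi _.
          rewrite <- HCi. destruct (Nat.eqb_spec (eu 1 + i) len); lia. }
        split; [exact Ha|]. destruct (HC i Hi) as [_ HCi]. rewrite Ha in HCi.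
        rewrite Hin in HCi by lia. injection HCi as _ HCi.
        unfold block. simpl. rewrite <- HCi. f_equal. lia. }
      assert (HE : forall t, eu 1 = S (t * S R) -> t <= n ->
        encodes R (block ei 0) (conf t) /\
        (t < n -> encodes R (block ei (S R)) (conf (S t)))).
      { intros t Ht Htn. assert (S t * S R <= len) by (apply Nat.mul_le_mono_r; lia).
        split; [|intros Htn'; assert (S (S t) * S R <= len) by (apply Nat.mul_le_mono_r; lia)];
          apply Hdat; intros i Hi.
        - destruct (HW i) as [_ ->]; [unfold window_size; lia|lia|]. f_equal. lia.
        - change (block ei (S R) i) with (block ei 0 (S R + i)).
          destruct (HW (S R + i)) as [_ ->]; [unfold window_size; lia|lia|]. f_equal. lia. }
      (* A negative value occurs only at remainder 0 modulo [S R], so such a window is aligned with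
         a configuration of the run. *)
      assert (HB : forall j, block ei 0 0 = (- Z.of_nat (S j))%Z ->
        exists t, eu 1 = S (t * S R) /\ t <= n /\ fst (conf t) = j).
      { intros j Hj. destruct (HW 0) as [_ HW0]; [unfold window_size; lia|lia|].
        rewrite Nat.add_0_r in HW0. rewrite HW0 in Hj.
        unfold dat in Hj. exists ((eu 1 - 1) / S R).
        pose proof (Nat.div_mod_eq (eu 1 - 1) (S R)) as HD.
        destruct ((eu 1 - 1) mod S R) as [|r]; [|lia].
        split; [lia|]. split; [|lia].
        apply Nat.lt_succ_r, Nat.Div0.div_lt_upper_bound. unfold len in Hr. lia. }
      split.
      * intros Hx. apply (sat_pc_regs 0 eu ei h R 0 init_term (0, initial m b)).
        -- intros r _. apply init_term_eval; assumption.
        -- apply (HE 0); lia.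
      * apply sat_trans. split.
        -- intros j i Hi Hj. destruct (HB j Hj) as (t & Ht & Htn & Hpc).
           destruct (HE t Ht Htn) as [HE0 HE1].
           (* At time [n] the counter is [length P], where no instruction stands; hence a successor
              configuration is stored whenever one is required. *)
           assert (Htl : t < n).
           { enough (t <> n) by lia. intros ->. unfold conf in Hpc. rewrite Hn in Hpc.
             simpl in Hpc. subst j.
             assert (length P < length P) by (apply nth_error_Some; congruence). lia. }
           specialize (HE1 Htl). change (conf (S t)) with (step P (conf t)) in HE1.
           destruct (conf t) as [pc rho1]. simpl in Hpc. subst pc.
           unfold step in HE1. simpl in HE1. rewrite Hi in HE1.
           apply (sat_exec 0 eu ei h R j i rho1); auto.
           eapply Forall_forall; [exact HP|]. eapply nth_error_In, Hi.
        -- intros Hj. destruct (HB _ Hj) as (t & Ht & Htn & Hpc).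
           destruct (HE t Ht Htn) as [[_ HE0] _].
           rewrite (HE0 2 HR).
           (* The machine may have halted before time [n]; it then stays put, so its output is
              already the final one. *)
           assert (Hstop : conf n = conf t).
           { unfold conf. replace n with (n - t + t) by lia. rewrite Nat.iter_add.
             fold (conf t). induction (n - t) as [|k IH]; [reflexivity|].
             simpl. rewrite IH. unfold step. rewrite Hpc.
             rewrite (proj2 (nth_error_None P (length P))) by lia. reflexivity. }
           rewrite <- Hstop. unfold conf. rewrite Hn. simpl. rewrite Ho. reflexivity.
Qed.

(** * Instances are closed and have the required prefix *)

Lemma closed_conj bu bi l :
  (forall f, In f l -> closed_in bu bi f) -> closed_in bu bi (FConj l).
Proof. induction l; simpl; auto. Qed.

Lemma qfree_conj l : (forall f, In f l -> qfree f) -> qfree (FConj l).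
Proof. induction l; simpl; auto. Qed.

Lemma machine_qfree R P : qfree (FMachine R P).
Proof.
  assert (Q : forall R o t, qfree (FRegs R o t)).
  { intros. apply qfree_conj. intros f Hf. apply in_map_iff in Hf as (r & <- & _).
    exact I. }
  simpl. repeat split; auto.
  - apply qfree_conj. intros f Hf. apply in_map_iff in Hf as (i & <- & _).
    simpl. auto.
  - apply qfree_conj. intros f Hf. apply in_map_iff in Hf as (j & <- & _).
    simpl. split; [exact I|].
    destruct (nth_error P j) as [[r e|r s l]|]; simpl; repeat split; apply Q.
Qed.

Lemma machine_closed R P bu bi :
  2 < R -> Forall (instr_bounded R) P ->
  (forall i, i <= S (window_size R) -> In i bu) ->
  (forall i, i <= S (window_size R) -> In i bi) ->
  closed_in bu bi (FMachine R P).
Proof.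
  unfold window_size. intros HR HP Hu Hi.
  assert (Q : forall o t, o <= S R -> (forall r, r < R -> ivars_ok bi (t r)) ->
    closed_in bu bi (FRegs R o t)).
  { intros o t Ho Ht. apply closed_conj. intros f Hf.
    apply in_map_iff in Hf as (r & <- & Hr). apply in_seq in Hr.
    simpl. split; [apply Hi; lia|apply Ht; lia]. }
  assert (Hreg : forall r, r < R -> ivars_ok bi (reg 0 r)).
  { intros r Hr. apply Hi. lia. }
  assert (Hpc : forall o j, o <= S R -> closed_in bu bi (FPc o j)).
  { intros o j Ho. split; [|exact I]. split; [apply Hi; lia|apply numeral_closed]. }
  assert (Hcell : forall i, i < S R + S R -> closed_in bu bi (FCellAt i)).
  { intros i Hi'. simpl. repeat split; first [apply Hu|apply Hi]; lia. }
  assert (Halloc : forall i, i <= 2 -> closed_in bu bi (FAlloc (UVar i))).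
  { intros i Hi'. simpl. repeat split; apply Hu; lia. }
  split; [apply Halloc; lia|]. split.
  - split; [apply Hcell; lia|apply Halloc; lia].
  - split; [|split].
    + apply closed_conj. intros f Hf. apply in_map_iff in Hf as (i & <- & Hi').
      apply in_seq in Hi'. apply Hcell. unfold window_size in Hi'. lia.
    + split; [split; apply Hu; lia|]. split; [apply Hpc; lia|].
      apply Q; [lia|]. intros [|[|r]] _; simpl; first [apply Hi; lia|exact I].
    + split.
      * apply closed_conj. intros f Hf. apply in_map_iff in Hf as (j & <- & _).
        split; [apply Hpc; lia|].
        destruct (nth_error P j) as [i|] eqn:E; [|simpl; auto].
        assert (HB : instr_bounded R i).
        { eapply Forall_forall; [exact HP|]. eapply nth_error_In, E. }
        destruct i as [r e|r s l]; simpl in HB.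
        -- split; [apply Hpc; lia|]. apply Q; [lia|]. intros r' Hr'.
           destruct (r' =? r); [|auto].
           destruct e; simpl in *; auto; split; auto; apply Hi; lia.
        -- destruct HB. split; [|apply Q; [lia|auto]].
           split; (split; [split; auto|apply Hpc; lia]).
      * split; [apply Hpc; lia|]. split; [apply Hreg; exact HR|exact I].
Qed.

Lemma instance_EA R P b :
  2 < R -> Forall (instr_bounded R) P ->
  EA_sentence (instance (S (window_size R)) b (FMachine R P)).
Proof.
  intros HR HP. set (m := S (window_size R)). split.
  - apply (window_closed _ m [0] [1; 0]). intros bu bi Iu Ii Hm.
    assert (H0 : In 0 bi /\ In 1 bi /\ In 0 bu).
    { repeat split; first [apply Ii|apply Iu]; simpl; auto. }
    destruct H0 as (Z1 & Z2 & X).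
    split; [split; (split; [assumption|apply numeral_closed])|].
    apply machine_closed; auto.
    + intros [|i] Hi; [exact X|]. apply Hm. exact Hi.
    + intros [|[|i]] Hi; [exact Z1|exact Z2|]. apply Hm. unfold m. lia.
  - exists [(SU, 0); (SI, 0); (SI, 1)], (window_vars m).
    eexists. split; [|reflexivity]. split; [split; exact I|apply machine_qfree].
Qed.

(** * Computing the code of an instance *)

(** The tags 7, 9 and 10 are those of [FNot], [FExU] and [FExI]; each universal quantifier
    contributes two negations. *)
Fixpoint window_code (m x : nat) : nat :=
  match m with
  | 0 => x
  | S m => npair 7 (npair 9 (npair (S m) (npair 7 (npair 7
             (npair 10 (npair (S (S m)) (npair 7 (window_code m x))))))))
  end.

Lemma enc_window m f :
  enc_form (all_prefix (window_vars m) f) = window_code m (enc_form f).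
Proof.
  induction m as [|m IH]; [reflexivity|].
  cbn [window_vars all_prefix FAllU FAllI enc_form window_code]. rewrite IH. reflexivity.
Qed.

(** Here [b] occurs twice, as the number whose numeral is written and as the code of the subformula:
    this is the diagonal substitution. *)
Definition instance_code (m b : nat) : nat :=
  npair 9 (npair 0 (npair 10 (npair 0 (npair 10 (npair 1
    (window_code m (npair 8 (npair (npair 8 (npair
       (npair 1 (npair (enc_i (IVar 0)) (enc_i (numeral m))))
       (npair 1 (npair (enc_i (IVar 1)) (enc_i (numeral b)))))) b)))))))).

Lemma enc_instance m f :
  enc_form (instance m (enc_form f) f) = instance_code m (enc_form f).
Proof.
  unfold instance, instance_code. cbn [enc_form]. rewrite enc_window. reflexivity.
Qed.

Ltac computable :=
  repeat first
    [ apply computable_const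
    | apply computable_proj; lia
    | apply computable_npair
    | apply computable_numeral
    | apply computable_succ ].

Lemma computable_window_code k f g :
  computable k f -> computable k g ->
  computable k (fun v => window_code (f v) (g v)).
Proof.
  apply (computable_app2 k window_code).
  apply (computable_prim 1 (fun v => nth 0 v 0)
    (fun v => npair 7 (npair 9 (npair (S (nth 0 v 0)) (npair 7 (npair 7
       (npair 10 (npair (S (S (nth 0 v 0))) (npair 7 (nth 1 v 0)))))))))).
  - computable.
  - computable.
  - reflexivity.
  - reflexivity.
Qed.

Lemma computable_instance_code :
  computable 2 (fun v => instance_code (nth 0 v 0) (nth 1 v 0)).
Proof.
  unfold instance_code. computable.
  apply computable_window_code; computable.
Qed.

(** * Diagonalization *)

(** Registers 0 and 1 are the inputs set by [initial], register 2 is the output tested on halting,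
    and scratch space starts at 3. *)
Lemma compiled_comp_run p c a b e y :
  peval c [a; b] e -> peval p [e] y ->
  let P := compile (PComp p [c]) [0; 1] 2 3 0 in
  exists n rho, Nat.iter n (step P) (0, initial a b) = (length P, rho) /\ rho 2 = y.
Proof.
  intros Hc Hp P.
  destruct (simulates_all (PComp p [c]) [a; b] y [0; 1] 2 3 0 (initial a b) P)
    as (rho & [n Hn] & Hy & _).
  - apply ev_comp with (ws := [e]); [|exact Hp]. constructor; [exact Hc|constructor].
  - exists [], []. rewrite app_nil_r. auto.
  - intros r [<-|[<-|[]]]; lia.
  - lia.
  - reflexivity.
  - exists n, rho. auto.
Qed.

(* Diagonalization: the machine encoded in the sentence computes the code of this
   very sentence, runs the decider on it and lets the sentence be satisfiable
   exactly if the answer is 0. *)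
Theorem theorem5 : ~ exists p : prf, decides_EA_sat p.
Proof.
  intros [p Hp].
  destruct computable_instance_code as [c Hc].
  set (P := compile (PComp p [c]) [0; 1] 2 3 0).
  destruct (bound_exists P) as (R & HR & HP).
  pose proof (Hp _ (instance_EA R P (enc_form (FMachine R P)) HR HP)) as [Hsat Hunsat].
  rewrite enc_instance in Hsat, Hunsat.
  pose proof (instance_sound R P (enc_form (FMachine R P))) as Hsound.
  pose proof (instance_complete R P (enc_form (FMachine R P))) as Hcomplete.
  revert Hsat Hunsat Hsound Hcomplete. cbv zeta.
  (* As variables, the code and the window length cannot be unfolded into huge numbers by
     conversion. *)
  generalize (enc_form (FMachine R P)) as b. generalize (S (window_size R)) as m.
  intros m b Hsat Hunsat Hsound Hcomplete.
  pose proof (Hc [m; b] eq_refl : peval c [m; b] (instance_code m b)) as Hcb.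
  destruct (classic (satisfiable (instance m b (FMachine R P)))) as [Hs|Hs].
  - destruct (compiled_comp_run p c m b _ _ Hcb (Hsat Hs)) as (n & rho & Hn & Hy).
    rewrite (Hsound n rho HR HP Hs Hn) in Hy. discriminate.
  - destruct (compiled_comp_run p c m b _ _ Hcb (Hunsat Hs)) as (n & rho & Hn & Hy).
    exact (Hs (Hcomplete n rho HR HP Hn Hy)).
Qed.
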